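(* Let $E$ be a Banach space such that the canonical embedding $i: E\longrightarrow E^{**}$ is a limited operator. Let $g: E^{**} \longrightarrow \mathbb{R} \cup \lbrace +\infty \rbrace$ be a convex lower semicontinuous function. Suppose that $x\in E$ belongs to the interior of $dom(g)$ and that $g$ is Gâteaux differentiable at $x$ (where $x$ is identified with $i(x)\in E^{**}$). Then the restriction of $g$ to $E$ is Fréchet differentiable at $x$. In particular, if $f : E \longrightarrow \mathbb{R} \cup \lbrace +\infty \rbrace$ is a convex lower semicontinuous function, $x\in E$ belongs to the interior of $dom((f^{*})^* )$ and $(f^{*})^*$ is Gâteaux differentiable at $x$, then $f$ is Fréchet differentiable at $x$.
   Context: Banach spaces are real, and $E$ is identified with the subspace $i(E)$ of $E^{**}$ via the canonical embedding; interiors of domains in $E^{**}$ and lower semicontinuity on $E$ and $E^{**}$ are with respect to the norm topology. A subset $A$ of a Banach space $X$ is called limited if every weak$^*$ null sequence $(p_n)_n$ in $X^*$ satisfies $\lim_{n\to+\infty}\sup_{x\in A}|\langle p_n,x\rangle|=0$. A bounded linear operator $T:Y\longrightarrow X$ is called limited if it maps the closed unit ball of $Y$ to a limited subset of $X$. For a function $f: X\longrightarrow\mathbb{R}\cup\{+\infty\}$ on a Banach space $X$, $dom(f):=\{x\in X : f(x)<+\infty\}$. For $f$ with $dom(f)\neq\emptyset$, the Fenchel transform of $f$ is defined on $X^*$ by $f^*(p):=\sup_{x\in X}\{\langle p,x\rangle-f(x)\}$ for $p\in X^*$; the second transform $(f^* )^*$ is defined on $X^{**}$ by the same formula, $(f^*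 )^*(z):=\sup_{p\in X^*}\{\langle z,p\rangle-f^*(p)\}$. *)

(* Defs.v *)
From HB Require Import structures.
From mathcomp Require Import all_boot all_order all_algebra.
From mathcomp Require Import all_classical all_reals all_analysis.
Import Order.TTheory GRing.Theory Num.Theory.
Import numFieldNormedType.Exports.

Set Implicit Arguments.
Unset Strict Implicit.
Unset Printing Implicit Defensive.

Local Open Scope classical_set_scope.
Local Open Scope ring_scope.

Section Dual.
Context {R : realType} {X : normedModType R}.

Definition continuous_functional : {pred X -> R} :=
  mem [set f : X -> R | scalar f /\ continuous f].

Lemma continuous_functional_submod_closed : submod_closed continuous_functional.
Proof.
split.
  rewrite inE /=; split; last by move=> x; exact: cvg_cst.
  by move=> a u v; rewrite /GRing.zero /= mulr0 addr0.
move=> a f g; rewrite !inE /= => -[lf cf] [lg cg]; split.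
  move=> b u v; rewrite /GRing.add /GRing.scale /=.
  move: (lf b u v) (lg b u v) => /= -> ->.
  by rewrite /GRing.scale /= !mulrDr addrACA !mulrA [a * b]mulrC.
move=> x; apply: (@cvgD _ R); last exact: cg.
by apply: (@cvgZl_tmp _ R); exact: cf.
Qed.

HB.instance Definition _ := GRing.isSubmodClosed.Build R (X -> R)
  continuous_functional continuous_functional_submod_closed.

Record dual : Type := Dual {
  dual_fun :> X -> R;
  _ : dual_fun \in continuous_functional
}.

HB.instance Definition _ := [isSub for dual_fun].
HB.instance Definition _ := [Choice of dual by <:].
HB.instance Definition _ := [SubChoice_isSubLmodule of dual by <:].

Lemma dual_scalar (p : dual) : scalar p.
Proof. by case: p => f /= /[!inE] -[]. Qed.

Lemma dual_continuous (p : dual) : continuous p.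
Proof. by case: p => f /= /[!inE] -[]. Qed.

HB.instance Definition _ (p : dual) :=
  GRing.isLinear.Build R X R _ (dual_fun p) (dual_scalar p).

Definition opnorm (p : dual) : R :=
  sup [set `|p x| | x in closed_ball (0 : X) 1].

Lemma unit_ballE (x : X) : closed_ball 0 1 x <-> `|x| <= 1.
Proof. by rewrite closed_ballE // /closed_ball_ /= sub0r normrN. Qed.

Lemma opnorm_has_sup (p : dual) :
  has_sup [set `|p x| | x in closed_ball (0 : X) 1].
Proof.
split; first by exists `|p 0|; exists 0 => //; apply/unit_ballE; rewrite normr0.
have /bounded_funP /(_ 1) [M pM] : bounded_near p (nbhs (0 : X)).
  exact/linear_bounded_continuous/dual_continuous.
by exists M => _ [x /unit_ballE x1 <-]; exact: pM.
Qed.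

Lemma opnorm_ub (p : dual) x : `|x| <= 1 -> `|p x| <= opnorm p.
Proof.
move=> x1; apply: ub_le_sup; first by case: (opnorm_has_sup p).
by exists x => //; exact/unit_ballE.
Qed.

Lemma opnorm_le (p : dual) M :
  (forall x, `|x| <= 1 -> `|p x| <= M) -> opnorm p <= M.
Proof.
move=> pM; apply: ge_sup; first by case: (opnorm_has_sup p).
by move=> _ [x /unit_ballE x1 <-]; exact: pM.
Qed.

Lemma opnorm_ge0 (p : dual) : 0 <= opnorm p.
Proof. by apply: le_trans (@opnorm_ub p 0 _); rewrite ?normr0. Qed.

Lemma opnormP (p : dual) x : `|p x| <= opnorm p * `|x|.
Proof.
have [->|x0] := eqVneq x 0; first by rewrite linear0 !normr0 mulr0.
rewrite -ler_pdivrMr ?normr_gt0//.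
have -> : `|p x| / `|x| = `|p (`|x|^-1 *: x)|.
  by rewrite linearZ /= normrM normfV normr_id mulrC.
by apply: opnorm_ub; rewrite normrZ normfV normr_id mulVf ?normr_eq0.
Qed.

Lemma opnormD (p q : dual) : opnorm (p + q) <= opnorm p + opnorm q.
Proof.
apply: opnorm_le => x x1; apply: le_trans (ler_normD _ _) _.
by rewrite lerD ?opnorm_ub.
Qed.

Lemma opnormZ_le (l : R) (p : dual) : opnorm (l *: p) <= `|l| * opnorm p.
Proof.
by apply: opnorm_le => x x1; rewrite normrM ler_wpM2l ?opnorm_ub.
Qed.

Lemma opnormZ (l : R) (p : dual) : opnorm (l *: p) = `|l| * opnorm p.
Proof.
apply/eqP; rewrite eq_le opnormZ_le /=.
have [->|l0] := eqVneq l 0; first by rewrite normr0 mul0r opnorm_ge0.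
rewrite -ler_pdivlMl ?normr_gt0// -normfV.
by rewrite -{1}[p](scalerK l0) opnormZ_le.
Qed.

Lemma opnorm0_eq0 (p : dual) : opnorm p = 0 -> p = 0.
Proof.
move=> p0; apply/val_inj/funext => x /=; apply/normr0_eq0/le_anti.
by rewrite normr_ge0 andbT (le_trans (opnormP p x))// p0 mul0r.
Qed.

HB.instance Definition _ :=
  Lmodule_isNormed.Build R dual opnormD opnormZ opnorm0_eq0.

End Dual.
Arguments dual {R} X.

Section Bidual.
Context {R : realType} {X : normedModType R}.

Lemma bidual_eval_subproof (x : X) :
  (fun p : dual X => p x) \in @continuous_functional R (dual X).
Proof.
have lin : scalar (fun p : dual X => p x) by [].
rewrite inE /=; split => //.
pose ev := HB.pack_for {scalar dual X} (fun p : dual X => p x)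
  (GRing.isLinear.Build R (dual X) R _ (fun p : dual X => p x) lin).
apply: (@bounded_linear_continuous _ _ _ ev); apply/bounded_funP => r.
exists (r * `|x|) => p pr; apply: le_trans (opnormP p x) _.
by rewrite ler_wpM2r.
Qed.

Definition bidual_embedding (x : X) : dual (dual X) :=
  Dual (bidual_eval_subproof x).

Lemma bidual_embedding_linear : linear bidual_embedding.
Proof.
by move=> a x y; apply/val_inj/funext => p /=; rewrite dual_scalar.
Qed.

HB.instance Definition _ := GRing.isLinear.Build R X (dual (dual X)) _
  bidual_embedding bidual_embedding_linear.

End Bidual.
Arguments bidual_embedding {R} X.

Section Limited.
Context {R : realType}.

(* The suprema are taken in the extended reals, so an unbounded A cannot satisfy
   the condition through the default value of the real-valued sup. *)
Definition limited_set (X : normedModType R) (A : set X) : Prop :=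
  forall p : nat -> dual X,
    (forall x : X, p n x @[n --> \oo] --> (0 : R)) ->
    ereal_sup [set `|p n x|%:E | x in A] @[n --> \oo] --> 0%E.

Definition limited_operator (Y X : normedModType R) (T : {linear Y -> X}) :=
  bounded_near T (nbhs (0 : Y)) /\ limited_set (T @` closed_ball (0 : Y) 1).

End Limited.

Section ExtendedFunctions.
Context {R : realType} {X : normedModType R}.
Implicit Type f : X -> \bar R.

Definition edom f : set X := [set x | (f x < +oo)%E].

(* At t = 0 and t = 1 the library convention 0 * +oo = 0 makes this an equality. *)
Definition econvex f : Prop :=
  forall (x y : X) (t : R), 0 <= t <= 1 ->
    (f (t *: x + (1 - t) *: y)%R <= t%:E * f x + (1 - t)%R%:E * f y)%E.

(* Points where f is +oo contribute -oo to the supremum. *)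
Definition fenchel f : dual X -> \bar R :=
  fun p => ereal_sup (range (fun x : X => ((p x)%:E - f x)%E)).

(* As fine sends infinite values to 0, the next two notions require f to be
   finite wherever the limit of the difference quotient inspects it. *)
Definition gateaux_differentiable f (x : X) : Prop :=
  exists p : dual X, forall h : X,
    (\forall t \near (0 : R), f (x + t *: h) \is a fin_num) /\
    is_derive x h (fine \o f) (p h).

Definition frechet_differentiable f (x : X) : Prop :=
  (\forall y \near x, f y \is a fin_num) /\ differentiable (fine \o f) x.

End ExtendedFunctions.

(* Main.v *)
Require Import Defs.
From HB Require Import structures.
From mathcomp Require Import all_boot all_order all_algebra.
From mathcomp Require Import all_classical all_reals all_analysis.
From mathcomp Require Import ring lra.
Import Order.TTheory GRing.Theory Num.Theory.
Import numFieldNormedType.Exports.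

Set Implicit Arguments.
Unset Strict Implicit.
Unset Printing Implicit Defensive.

Local Open Scope classical_set_scope.
Local Open Scope ring_scope.

(** Write [i] for the canonical embedding, [z = i x], and let [p] be the
    Gateaux derivative of [g] at [z].

    Since the bidual is complete, Baire's theorem bounds the lower
    semicontinuous convex function [g] above on some ball; convexity carries
    the bound to a ball around [z] ([lsc_bounded_above_near]) and yields, by
    the Hahn-Banach theorem, a constant [L] such that [g] has a subgradient
    of norm at most [L] at every point near [z] ([subgradient_near]). When
    points [w_n] tend to [z], any choice of subgradients [q_n] of norm at
    most [L] at [w_n] tends weak* to [p] ([gateaux_subgradient_cvg]); in
    particular [p] is itself a subgradient.

    If the restriction of [g] to [E] were not Frechet differentiable at [x],
    there would be [h_n] tending to [0] and [e > 0] such that [g (z + i h_n)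
    - g z - p (i h_n) > e * `|h_n|]. A subgradient [q_n] at [z + i h_n] then
    satisfies [(q_n - p) (i h_n) > e * `|h_n|], so the weak* null sequence
    [q_n - p] is not uniformly small on the image of the unit ball. This
    contradicts the assumption that [i] is limited
    ([limited_gateaux_frechet]).

    For the second part, the biconjugate of [f] is convex and lower
    semicontinuous, and its finiteness at [i x] provides a point where the
    transform of [f] is finite. By the Fenchel-Moreau theorem
    ([fenchel_moreau]) the restriction of the biconjugate to [E] is then
    [f], and the first part applies.

    Both uses of the Hahn-Banach theorem go through [affine_minorant]: an
    affine function fits between a convex function and a cone [c - L * `|v -
    y|] below it. *)

(** * Sublinear functionals and the Hahn-Banach theorem *)

Section Sublinear.
Context {R : realType} {X : lmodType R}.
Implicit Types (q s : X -> R) (x y : X).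

(** Positive homogeneity is asked for as an inequality and for positive
    factors only; equality for nonnegative factors follows. *)
Definition sublinear q :=
  (forall x y, q (x + y) <= q x + q y) /\
  (forall t x, 0 < t -> q (t *: x) <= t * q x).

Lemma sublinear0 q : sublinear q -> q 0 = 0.
Proof.
move=> [_ qZ]; have := qZ 2 0; have := qZ 2^-1 0.
by rewrite !scaler0 invr_gt0 ltr0n => /(_ isT) + /(_ isT); lra.
Qed.

Lemma sublinearZ q t x : sublinear q -> 0 <= t -> q (t *: x) = t * q x.
Proof.
move=> sq; rewrite le_eqVlt => /predU1P[<-|t0].
  by rewrite scale0r mul0r sublinear0.
have [_ qZ] := sq; apply/le_anti; rewrite qZ//=.
have := qZ t^-1 (t *: x); rewrite invr_gt0 t0 => /(_ isT).
by rewrite scalerA mulVf ?gt_eqF// scale1r ler_pdivlMl.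
Qed.

Lemma sublinearN q x : sublinear q -> - q (- x) <= q x.
Proof.
move=> sq; have [qD _] := sq; have := qD x (- x).
by rewrite subrr sublinear0//; lra.
Qed.

(** A pointwise infimum of values is sublinear as soon as the values themselves
    are subadditive and positively homogeneous up to passing to smaller ones. *)
Lemma sublinear_inf (A : X -> set R) :
  (forall x, A x !=set0) -> (forall x, has_lbound (A x)) ->
  (forall x y a b, A x a -> A y b -> exists2 c, A (x + y) c & c <= a + b) ->
  (forall t x a, 0 < t -> A x a -> exists2 c, A (t *: x) c & c <= t * a) ->
  sublinear (fun x => inf (A x)).
Proof.
move=> A0 Al AD AZ; split=> [x y|t x t0].
  rewrite -lerBlDr; apply: lb_le_inf => // a Aa.
  rewrite lerBlDr -lerBlDl; apply: lb_le_inf => // b Ab.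
  rewrite lerBlDl; have [c Ac cab] := AD _ _ _ _ Aa Ab.
  by apply: le_trans cab; exact: ge_inf.
rewrite -ler_pdivrMl//; apply: lb_le_inf => // a Aa.
rewrite ler_pdivrMl//; have [c Ac ca] := AZ _ _ _ t0 Aa.
by apply: le_trans ca; exact: ge_inf.
Qed.

(** [q] is minimal, for the pointwise order, among the sublinear functionals
    below [s]. *)
Definition minimal_sublinear s q :=
  [/\ sublinear q, forall x, q x <= s x &
    forall r, sublinear r -> (forall x, r x <= q x) -> forall x, q x <= r x].

(** Zorn's lemma; the infimum of a chain is a lower bound for it. *)
Lemma exists_minimal_sublinear s :
  sublinear s -> exists q, minimal_sublinear s q.
Proof.
move=> ss; pose T := {q : X -> R | sublinear q /\ forall x, q x <= s x}.
pose mk q (sq : sublinear q) (qs : forall x, q x <= s x) : T :=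
  exist _ q (conj sq qs).
pose le_ (q r : T) := `[< forall x, sval r x <= sval q x >].
have [||A tA|q qm] := @ZL_preorder T (mk s ss (fun=> lexx _)) le_.
- by move=> q; apply/asboolP.
- move=> q r u /asboolP rq /asboolP ur; apply/asboolP => x.
  exact: le_trans (rq x).
- have [[q0 Aq0]|A0] := pselect (A !=set0); last first.
    exists (mk s ss (fun=> lexx _)) => q Aq.
    by exfalso; apply: A0; exists q.
  pose B x := [set sval q x | q in A].
  have Bl x : has_lbound (B x).
    exists (- s (- x)) => _ [[q [sq qs]] _ <-] /=.
    by apply: le_trans (sublinearN x sq); rewrite lerN2.
  have sB : sublinear (fun x => inf (B x)).
    apply: sublinear_inf => //.
    - by move=> x; exists (sval q0 x); exists q0.
    - move=> x y _ _ [q Aq <-] [r Ar <-].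
      (* of two members of the chain, the smaller one serves for the sum *)
      have [/asboolP rq|/asboolP qr] := tA _ _ Aq Ar.
      + exists (sval r (x + y)); first by exists r.
        case: (svalP r) => -[+ _] _; move=> /(_ x y) /le_trans; apply.
        by rewrite lerD2r.
      + exists (sval q (x + y)); first by exists q.
        case: (svalP q) => -[+ _] _; move=> /(_ x y) /le_trans; apply.
        by rewrite lerD2l.
    - move=> t x _ t0 [q Aq <-]; exists (sval q (t *: x)); first by exists q.
      by case: (svalP q) => -[_ +] _; apply.
  have Bs x : inf (B x) <= s x.
    apply: (@le_trans _ _ (sval q0 x)); last by case: (svalP q0).
    by apply: ge_inf => //; exists q0.
  exists (mk _ sB Bs) => q Aq; apply/asboolP => x /=.
  by apply: ge_inf => //; exists q.
- exists (sval q); case: (svalP q) => sq qs; split=> // r sr rq.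
  have rs x : r x <= s x by exact: le_trans (qs x).
  by apply/asboolP; apply: (qm (mk r sr rs)); exact/asboolP.
Qed.

(** A minimal sublinear functional is linear: minimality is tested against the
    functional sending [x] to the infimum of
    [q (x + t *: y) - t * q y] over [t >= 0], for each fixed [y]. *)
Lemma minimal_sublinear_scalar s q : minimal_sublinear s q -> scalar q.
Proof.
move=> [sq _ qmin]; have [qD _] := sq.
have qDge x y : q x + q y <= q (x + y).
  pose B x := [set q (x + t *: y) - t * q y | t in [set t | 0 <= t]].
  have Bl u : has_lbound (B u).
    exists (- q (- u)) => _ [t /= t0 <-].
    rewrite -(sublinearZ y sq t0); have := qD (u + t *: y) (- u).
    by rewrite addrAC subrr add0r; lra.
  have sB : sublinear (fun u => inf (B u)).
    apply: sublinear_inf => //.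
    - by move=> u; exists (q (u + 0 *: y) - 0 * q y); exists 0 => /=.
    - move=> u v _ _ [t /= t0 <-] [r /= r0 <-].
      exists (q (u + v + (t + r) *: y) - (t + r) * q y).
        by exists (t + r) => //=; rewrite addr_ge0.
      have := qD (u + t *: y) (v + r *: y).
      by rewrite addrACA -scalerDl mulrDl; lra.
    - move=> t u _ t0 [r /= r0 <-].
      exists (q (t *: u + (t * r) *: y) - (t * r) * q y).
        by exists (t * r) => //=; rewrite mulr_ge0// ltW.
      by rewrite -scalerA -scalerDr (sublinearZ _ sq (ltW t0)) mulrBr mulrA.
  have Bq u : inf (B u) <= q u.
    apply: ge_inf => //; exists 0 => //=.
    by rewrite scale0r addr0 mul0r subr0.
  have := qmin _ sB Bq x.
  rewrite -lerBrDr => /le_trans; apply; apply: ge_inf => //.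
  by exists 1 => /=; rewrite ?scale1r ?mul1r.
have qDE x y : q (x + y) = q x + q y by apply/le_anti; rewrite qD qDge.
have qN x : q (- x) = - q x.
  by have := qDE x (- x); rewrite subrr (sublinear0 sq); lra.
move=> a u v; rewrite qDE; congr (_ + _).
have [a0|a0] := leP 0 a; first exact: sublinearZ.
have -> : a *: u = - (- a *: u) by rewrite scaleNr opprK.
by rewrite qN (sublinearZ _ sq) ?oppr_ge0 ?ltW// mulNr opprK.
Qed.

Theorem hahn_banach_sublinear s : sublinear s ->
  exists2 p : X -> R, scalar p & forall x, p x <= s x.
Proof.
move=> /exists_minimal_sublinear[q qm]; exists q; last by case: qm.
exact: minimal_sublinear_scalar qm.
Qed.

End Sublinear.

(** * Affine minorants of convex functions *)

Section Convexity.
Context {R : realType} {X : normedModType R}.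
Implicit Types f : X -> \bar R.

Lemma econvex_le f x y (t a b : R) : econvex f -> 0 <= t <= 1 ->
  (f x <= a%:E -> f y <= b%:E ->
   f (t *: x + (1 - t) *: y)%R <= (t * a + (1 - t) * b)%:E)%E.
Proof.
move=> cf t01 fa fb; have /andP[t0 t1] := t01.
apply: le_trans (cf _ _ _ t01) _; rewrite [leRHS]EFinD !EFinM.
by apply: leeD; apply: lee_wpmul2l; rewrite // lee_fin// subr_ge0.
Qed.

Lemma bounded_scalar_dual (p : X -> R) L : 0 <= L -> scalar p ->
  (forall x, p x <= L * `|x|) ->
  exists2 q : dual X, q =1 p & `|q| <= L.
Proof.
move=> L0 lin pL.
pose p' := HB.pack_for {scalar X} p (GRing.isLinear.Build R X R _ p lin).
have pL' x : `|p x| <= L * `|x|.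
  by rewrite ler_norml pL andbT lerNl -(linearN p') -(normrN x) pL.
have cp : continuous p.
  apply: (@bounded_linear_continuous _ _ _ p'); apply/bounded_funP => r.
  by exists (L * r) => x xr; apply: le_trans (pL' x) _; exact: ler_wpM2l.
have pin : p \in @continuous_functional R X by rewrite inE.
exists (Dual pin) => //; apply: opnorm_le => x x1.
by apply: le_trans (pL' x) _; rewrite ler_piMr.
Qed.

(** A sandwich theorem: an affine function fits between a convex function and
    a concave cone lying below it. It comes from the Hahn-Banach theorem applied
    to the sublinear functional sending [h] to the infimum of
    [l * (f v - c) + L * `|h - l *: (v - y)|] over [l >= 0] and [v] in the
    domain of [f]; below, [r] runs over the real numbers above [f v]. *)
Theorem affine_minorant f (c L : R) (y : X) : econvex f -> 0 <= L ->
  (forall v, (c - L * `|v - y|)%:E <= f v)%E ->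
  exists2 p : dual X, `|p| <= L & forall v, ((c + p (v - y))%:E <= f v)%E.
Proof.
move=> cf L0 fL.
have [[v0 [r0 fv0]]|foo] := pselect (exists v r, (f v <= r%:E)%E); last first.
  exists 0; first by rewrite normr0.
  move=> v; have [//|/ltW] := leP (c + (0 : dual X) (v - y))%:E (f v).
  by move=> fv; exfalso; apply: foo; exists v; eexists; exact: fv.
pose B h := [set b | exists l v r, [/\ 0 <= l, (f v <= r%:E)%E &
  b = l * (r - c) + L * `|h - l *: (v - y)|]].
have Bl h : has_lbound (B h).
  exists (- (L * `|h|)) => _ [l [v [r [l0 fvr ->]]]].
  have : c - L * `|v - y| <= r by rewrite -lee_fin; exact: le_trans fvr.
  rewrite lerBlDr -lerBlDl -opprB lerNl => /(ler_wpM2l l0).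
  have : L * `|l *: (v - y)| <= L * (`|h - l *: (v - y)| + `|h|).
    apply: ler_wpM2l => //; rewrite -{1}[l *: (v - y)](subKr h).
    by apply: le_trans (ler_normB _ _) _; rewrite addrC.
  rewrite normrZ (ger0_norm l0) mulrN mulrCA; lra.
have B0 h : B h (L * `|h|).
  by exists 0, v0, r0; split; rewrite // mul0r add0r scale0r subr0.
have sB : sublinear (fun h => inf (B h)).
  apply: sublinear_inf => //.
  - by move=> h; exists (L * `|h|).
  - move=> h1 h2 _ _ [l1 [v1 [r1 [l10 f1 ->]]]] [l2 [v2 [r2 [l20 f2 ->]]]].
    have [l120|l120] := eqVneq (l1 + l2) 0.
      have [-> ->] : l1 = 0 /\ l2 = 0 by split; lra.
      exists (L * `|h1 + h2|); first exact: B0.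
      by rewrite !scale0r !subr0 !mul0r !add0r -mulrDr ler_wpM2l// ler_normD.
    have l0 : 0 < l1 + l2 by rewrite lt_neqAle eq_sym l120 addr_ge0.
    pose t := l1 / (l1 + l2).
    have lt1 : (l1 + l2) * t = l1 by rewrite /t mulrC divfK.
    have lt2 : (l1 + l2) * (1 - t) = l2 by rewrite mulrBr lt1 mulr1 addrC addKr.
    have t01 : 0 <= t <= 1.
      by rewrite /t divr_ge0 ?addr_ge0//= ler_pdivrMr// mul1r lerDl.
    clearbody t.
    exists (l1 * (r1 - c) + l2 * (r2 - c)
            + L * `|h1 + h2 - (l1 *: (v1 - y) + l2 *: (v2 - y))|).
      exists (l1 + l2), (t *: v1 + (1 - t) *: v2), (t * r1 + (1 - t) * r2).
      split; [by rewrite addr_ge0|exact: econvex_le|].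
      have -> : (l1 + l2) * (t * r1 + (1 - t) * r2 - c) =
          l1 * (r1 - c) + l2 * (r2 - c).
        by rewrite -{2}lt1 -{3}lt2; ring.
      have -> // : (l1 + l2) *: (t *: v1 + (1 - t) *: v2 - y) =
          l1 *: (v1 - y) + l2 *: (v2 - y).
      rewrite -{2}lt1 -{3}lt2 -!scalerA -scalerDr; congr (_ *: _).
      rewrite !scalerBr addrACA; congr (_ + _).
      by rewrite -opprD -scalerDl addrC subrK scale1r.
    rewrite opprD addrACA.
    have : L * `|h1 - l1 *: (v1 - y) + (h2 - l2 *: (v2 - y))| <=
        L * (`|h1 - l1 *: (v1 - y)| + `|h2 - l2 *: (v2 - y)|).
      by rewrite ler_wpM2l// ler_normD.
    by lra.
  - move=> t h _ t0 [l [v [r [l0 fvr ->]]]].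
    exists (t * l * (r - c) + L * `|t *: h - (t * l) *: (v - y)|).
      by exists (t * l), v, r; split; rewrite // mulr_ge0// ltW.
    rewrite -scalerA -scalerBr normrZ (ger0_norm (ltW t0)).
    by rewrite [leRHS]mulrDr mulrA (mulrCA t L).
have [p plin pB] := hahn_banach_sublinear sB.
have [x|q qp qL] := bounded_scalar_dual L0 plin.
  by apply: le_trans (pB x) _; exact: ge_inf.
exists q => // v; rewrite qp.
case fvr : (f v) => [r||]; rewrite ?leey//; last first.
  by have := fL v; rewrite fvr.
rewrite lee_fin -lerBrDl; apply: le_trans (pB _) _; apply: ge_inf => //.
exists 1, v, r; split; rewrite ?fvr// mul1r scale1r subrr normr0 mulr0 addr0//.
Qed.

End Convexity.

(** * Completeness of the dual space *)

Section DualComplete.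
Context {R : realType} {X : normedModType R}.

Lemma dual_normP (p : dual X) x : `|p x| <= `|p| * `|x|.
Proof. exact: opnormP. Qed.

(** A Cauchy filter of functionals converges pointwise; the limit is a bounded
    functional, and the convergence is uniform on the unit ball. *)
Lemma dual_complete (F : set_system (dual X)) :
  ProperFilter F -> cauchy F -> cvg F.
Proof.
move=> FF /cauchyP Fc.
have ev_cvg x : cvg ((fun p : dual X => p x) @ F).
  apply: cauchy_cvg; apply/cauchyP => e e0.
  have e'0 : 0 < e / (`|x| + 1) by rewrite divr_gt0// ltr_wpDl.
  have [p0 Fp0] := Fc _ e'0; exists (p0 x).
  apply: (@filterS (dual X) F _ _ _ _ Fp0) => p.
  rewrite -!ball_normE /= => pp0; rewrite -[p0 x - p x]/((p0 - p) x).
  apply: le_lt_trans (dual_normP (p0 - p) x) _.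
  apply: (@le_lt_trans _ _ (`|p0 - p| * (`|x| + 1))).
    by apply: ler_wpM2l => //; rewrite lerDl.
  by rewrite -ltr_pdivlMr// ltr_wpDl.
pose l x : R := lim ((fun p : dual X => p x) @ F).
have lP x : (fun p : dual X => p x) @ F --> l x by exact: ev_cvg.
have lE e p0 x : F (ball p0 e) -> `|l x - p0 x| <= e * `|x|.
  move=> Fp0.
  have cv : (fun p : dual X => `|p x - p0 x|) @ F --> `|l x - p0 x|.
    by apply: cvg_norm; apply: cvgB => //; exact: cvg_cst.
  rewrite -(cvg_lim _ cv)//; apply: limr_le; first exact: cvgP cv.
  apply: (@filterS (dual X) F _ _ _ _ Fp0) => p.
  rewrite -ball_normE /= distrC => pp0.
  rewrite -[p x - p0 x]/((p - p0) x).
  by apply: le_trans (dual_normP (p - p0) x) _; rewrite ler_wpM2r// ltW.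
have lin : scalar l.
  move=> a u v; apply: cvg_lim => //.
  under eq_fun do rewrite dual_scalar.
  by apply: cvgD => //; apply: cvgMl_tmp.
have [p0 Fp0] := Fc _ ltr01.
have M0 : 0 <= `|p0| + 1 by rewrite addr_ge0.
have [x|q ql _] := bounded_scalar_dual M0 lin.
- have := lE _ _ x Fp0; have := dual_normP p0 x.
  have : p0 x <= `|p0 x| by exact: ler_norm.
  have : l x - p0 x <= `|l x - p0 x| by exact: ler_norm.
  rewrite mulrDl; lra.
- apply/cvg_ex; exists q; apply/cvgrPdist_le => e e0.
  have [p1 Fp1] := Fc _ (divr_gt0 e0 (@ltr0n R 2)).
  apply: (@filterS (dual X) F _ _ _ _ Fp1) => p; rewrite -ball_normE /= => pp1.
  apply: opnorm_le => x x1.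
  have := lE _ _ x Fp1; have := dual_normP (p1 - p) x.
  have -> : (q - p) x = (l x - p1 x) + (p1 - p) x.
    by rewrite -ql addrA subrK.
  have := ler_normD (l x - p1 x) ((p1 - p) x).
  have : `|p1 - p| * `|x| <= e / 2 * 1 by rewrite ler_pM// ltW.
  have : e / 2 * `|x| <= e / 2 * 1 by rewrite ler_wpM2l// divr_ge0// ltW.
  lra.
Qed.

HB.instance Definition _ := Uniform_isComplete.Build (dual X) dual_complete.

End DualComplete.

(** * Continuity and subgradients of convex functions *)

Section Subgradient.
Context {R : realType} {X : normedModType R}.
Implicit Types (g : X -> \bar R) (z w v : X) (q : dual X).

(** [g] is bounded above by a real number on some closed ball around [z]. *)
Definition bounded_above_near g z : Prop :=
  exists M r : R, 0 < r /\ forall w, `|w - z| <= r -> (g w <= M%:E)%E.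

(** By convexity, a bound on some ball, wherever it is, can be carried to a
    ball around any interior point of the domain. *)
Lemma econvex_bounded_above_near g z w0 (M0 r0 : R) :
  econvex g -> interior (edom g) z -> 0 < r0 ->
  (forall w, `|w - w0| < r0 -> (g w <= M0%:E)%E) -> bounded_above_near g z.
Proof.
move=> cg /nbhs_ballP[d /= d0 zd] r00 gM0.
pose D := `|w0 - z| + 1.
have D0 : 0 < D by rewrite ltr_wpDl.
(* [u] lies in the domain, beyond [z] on the line coming from [w0] *)
pose l := d / 2 / D; pose u := z - l *: (w0 - z).
have l0 : 0 < l by rewrite !divr_gt0.
have [M1 gM1] : exists M1 : R, (g u <= M1%:E)%E.
  have : (g u < +oo)%E.
    apply: zd; rewrite -ball_normE /= /u opprB addrCA subrr addr0 normrZ.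
    have lD : l * `|w0 - z| < l * D by rewrite ltr_pM2l// ltrDl.
    rewrite gtr0_norm// (lt_trans lD)// /l divfK ?gt_eqF//.
    by rewrite ltr_pdivrMr// ltr_pMr// ltr1n.
  by case: (g u) => [a _|//|_]; [exists a|exists 0; rewrite leNye].
pose t := l / (1 + l).
have l1 : 0 < 1 + l by rewrite addr_gt0.
have t0 : 0 < t by rewrite divr_gt0.
have t01 : 0 <= t <= 1 by rewrite ltW//= ler_pdivrMr// mul1r lerDr.
have t1l : (1 - t) * l = t.
  by rewrite /t -{1}(divff (lt0r_neq0 l1)) -mulrBl addrK mul1r mulrC.
exists (t * M0 + (1 - t) * M1), (t * (r0 / 2)); split.
  by rewrite mulr_gt0// divr_gt0.
move=> w wz.
have -> : w = t *: (w0 + t^-1 *: (w - z)) + (1 - t) *: u.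
  rewrite /u (scalerBr (1 - t)) scalerA t1l scalerDr scalerA.
  rewrite divff ?gt_eqF// scale1r.
  rewrite scalerBl scale1r !scalerBr opprB (addrA (z - _)) subrK.
  by rewrite addrA -(addrA (t *: w0)) subrK addrAC subrr add0r.
apply: econvex_le => //; apply: gM0.
rewrite addrAC subrr add0r normrZ gtr0_norm ?invr_gt0//.
rewrite -ltr_pdivlMl ?invr_gt0//.
by rewrite invrK (le_lt_trans wz)// ltr_pM2l// ltr_pdivrMr// ltr_pMr// ltr1n.
Qed.

(** [q] is a subgradient of [g] at a point [w] where [g] is finite. *)
Definition subgradient g w q : Prop := g w \is a fin_num /\
  forall v, ((fine (g w) + q (v - w))%:E <= g v)%E.

(** The norms of the subgradients obtained around [z] share the bound [L]. *)
Lemma subgradient_near g z : (forall w, g w != -oo%E) -> econvex g ->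
  bounded_above_near g z ->
  exists L r : R, [/\ 0 <= L, 0 < r & forall w, `|w - z| <= r ->
    g w \is a fin_num /\ exists2 q, `|q| <= L & subgradient g w q].
Proof.
move=> gN cg [M [r [r0 gM]]].
have gfin w : `|w - z| <= r -> g w \is a fin_num.
  by move=> /gM wM; rewrite fin_numE gN/= lt_eqF// (le_lt_trans wM)// ltry.
have gzE : g z = (fine (g z))%:E by rewrite fineK// gfin// subrr normr0 ltW.
set b := fine (g z) in gzE.
have bM : b <= M by rewrite -lee_fin -gzE gM// subrr normr0 ltW.
(* lower bound by reflection through [z] *)
have glb w : `|w - z| <= r -> 2 * b - M <= fine (g w).
  move=> wr; have wE : g w = (fine (g w))%:E by rewrite fineK// gfin.
  have h01 : 0 <= (2^-1 : R) <= 1 by lra.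
  have := @econvex_le _ _ g w (z - (w - z)) 2^-1 (fine (g w)) M cg h01.
  rewrite -wE lexx => /(_ isT).
  have -> : 2^-1 *: w + (1 - 2^-1) *: (z - (w - z)) = z.
    have -> : 1 - 2^-1 = 2^-1 :> R by lra.
    rewrite -scalerDr opprB addrCA (addrCA w) subrr addr0 scalerDr.
    by rewrite -scalerDl -div1r -splitr scale1r.
  have -> : (g (z - (w - z))%R <= M%:E)%E.
    by apply: gM; rewrite addrAC subrr add0r normrN.
  move=> /(_ isT); rewrite gzE lee_fin; lra.
pose s := r / 2; have s0 : 0 < s by rewrite divr_gt0.
pose L := (2 * M - 2 * b) / s.
have L0 : 0 <= L by rewrite divr_ge0 ?(ltW s0)//; lra.
exists L, s; split=> // w ws.
have wr : `|w - z| <= r by rewrite (le_trans ws)// /s; lra.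
split; first exact: gfin.
(* [g] lies above a cone with apex at [w]: the point [u] beyond [w] on the line
   coming from [v] stays in the ball where [g] is at most [M] *)
suff : forall v, ((fine (g w) - L * `|v - w|)%:E <= g v)%E.
  move=> /(affine_minorant cg L0)[q qL qg]; exists q => //.
  by split; first exact: gfin.
move=> v; case gvE : (g v) (gN v) => [a||]// _; last by rewrite leey.
have [vw|vw] := eqVneq v w.
  by rewrite -vw gvE subrr normr0 mulr0 subr0.
pose d := `|v - w|; have d0 : 0 < d by rewrite normr_gt0 subr_eq0.
pose u := w - (s / d) *: (v - w).
have gu : (g u <= M%:E)%E.
  apply: gM; rewrite /u addrAC; apply: le_trans (ler_normB _ _) _.
  rewrite normrZ gtr0_norm ?divr_gt0// -/d divfK ?gt_eqF//.
  by rewrite /s in ws *; lra.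
have sd0 : 0 < s + d by rewrite addr_gt0.
pose t := s / (s + d).
have t01 : 0 <= t <= 1.
  by rewrite divr_ge0 ?(ltW s0) ?(ltW sd0)//= ler_pdivrMr// mul1r lerDl ltW.
have t1 : 1 - t = d / (s + d).
  by rewrite /t -{1}(divff (lt0r_neq0 sd0)) -mulrBl addrAC subrr add0r.
have := econvex_le cg t01 _ gu; rewrite -/t => /(_ v a).
rewrite gvE lexx => /(_ isT).
have -> : t *: v + (1 - t) *: u = w.
  have t1sd : (1 - t) * (s / d) = t by rewrite t1 /t; field; rewrite !gt_eqF.
  rewrite /u scalerBr scalerA t1sd scalerBr opprB.
  by rewrite (addrA (_ *: w)) -scalerDl subrK scale1r addrCA subrr addr0.
rewrite -(fineK (gfin _ wr)) !lee_fin.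
rewrite t1 /t mulrAC [d / _ * _]mulrAC -mulrDl ler_pdivlMr// => H.
have := glb _ wr; rewrite -/d.
have -> : fine (g w) - L * d = (s * fine (g w) - (2 * M - 2 * b) * d) / s.
  by rewrite /L; field; rewrite gt_eqF.
rewrite ler_pdivrMr// => H2.
have : d * (2 * b - M) <= d * fine (g w) by rewrite ler_pM2l.
nra.
Qed.

End Subgradient.

(** Otherwise the open sets where [g > n] would all be dense, and Baire's
    theorem would give a point of the domain where [g] is infinite. *)
Lemma lsc_bounded_above_near {R : realType} {X : completeNormedModType R}
    (g : X -> \bar R) z :
  econvex g -> lower_semicontinuous g -> interior (edom g) z ->
  bounded_above_near g z.
Proof.
move=> cg /lower_semicontinuousP og zg.
pose O (n : nat) := [set w | (n%:R%:E < g w)%E].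
have [n nd] : exists n, ~ dense (O n).
  apply: contrapT => /forallNP dO.
  have /Baire : forall n, open (O n) /\ dense (O n).
    by move=> n; split; [exact: og|exact: contrapT].
  move=> /(_ (interior (edom g))) [||w [/interior_subset /= wg wO]].
  - by exists z.
  - exact: open_interior.
  - case gw : (g w) wg => [a||] wg; last by have := wO 0 I; rewrite /O /= gw.
      have := wO (Num.truncn a).+1 I; rewrite /O /= gw lte_fin ltNge.
      by rewrite ltW// truncnS_gt.
    by rewrite /edom /= gw ltxx in wg.
have [U [[w0 Uw0] oU UO]] : exists U, [/\ U !=set0, open U & U `&` O n = set0].
  apply: contrapT => H; apply: nd => U U0 oU; apply: contrapT => UO.
  apply: H; exists U; split=> //; apply/seteqP; split=> // x Ux.
  by apply: UO; exists x.
have /nbhs_ballP[r /= r0 rU] : nbhs w0 U by exact: open_nbhs_nbhs.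
apply: (@econvex_bounded_above_near _ _ g z w0 n%:R r) => // w wr.
rewrite leNgt; apply/negP => gw.
have : (U `&` O n) w by split=> //; apply: rU; rewrite -ball_normE /= distrC.
by rewrite UO.
Qed.

(** * Subgradients near a point of Gateaux differentiability *)

Section Gateaux.
Context {R : realType} {X : normedModType R}.
Implicit Types (g : X -> \bar R) (z w v : X) (p q : dual X).

(** [p] is a Gateaux derivative of [g] at [z], so that [gateaux_differentiable]
    asserts the existence of some [p] with this property. *)
Definition gateaux_derivative g z p : Prop := forall h : X,
  (\forall t \near (0 : R), g (z + t *: h) \is a fin_num) /\
  is_derive z h (fine \o g) (p h).

Lemma gateaux_derivative_quotient g z p v (e : R) :
  gateaux_derivative g z p -> 0 < e ->
  exists2 s : R, 0 < s & g (z + s *: v) \is a fin_num /\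
    fine (g (z + s *: v)) - fine (g z) <= s * (p v + e).
Proof.
move=> /(_ v)[gfin [dg dgE]] e0.
have /cvgrPdist_le/(_ _ e0) : (fun t : R => t^-1 *: (((fine \o g) \o shift z)
    (t *: v) - (fine \o g) z)) @ 0^' --> p v by rewrite -dgE; exact: dg.
move=> /nbhs_ballP[d1 /= d10 H1].
have /nbhs_ballP[d2 /= d20 H2] := gfin.
pose s := Num.min d1 d2 / 2.
have m0 : 0 < Num.min d1 d2 by rewrite lt_min d10.
have s0 : 0 < s by rewrite divr_gt0.
have : s < Num.min d1 d2 by rewrite ltr_pdivrMr// ltr_pMr// ltr1n.
rewrite lt_min => /andP[sd1 sd2].
have bs d : s < d -> ball 0 d s.
  by rewrite -ball_normE /= sub0r normrN gtr0_norm.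
exists s => //; split; first exact/H2/bs.
have := H1 s (bs _ sd1) (lt0r_neq0 s0); rewrite /= [_ + z]addrC distrC.
move=> /(le_trans (ler_norm _)); rewrite lerBlDl.
by rewrite ler_pdivrMl.
Qed.

(** One-sided form of [gateaux_subgradient_cvg]. The subgradient [q0] serves to
    bound [g w] below by [g z - L * `|w - z|]. *)
Lemma gateaux_subgradient_le g z p q0 v (L e : R) :
  gateaux_derivative g z p -> subgradient g z q0 -> `|q0| <= L -> 0 < e ->
  exists2 d : R, 0 < d & forall w q, `|w - z| <= d -> subgradient g w q ->
    `|q| <= L -> q v <= p v + e.
Proof.
move=> dg [gz q0g] q0L e0.
have L0 : 0 <= L by rewrite (le_trans _ q0L).
have e20 : 0 < e / 2 by rewrite divr_gt0.
have [s s0 [gs gsp]] := gateaux_derivative_quotient v dg e20.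
(* replacing [z] by [w] costs at most [2 * L * `|w - z|], to be kept below
   [s * e / 2]; adding [1] to [L] avoids a zero denominator *)
exists (s * e / (4 * (L + 1))).
  by rewrite divr_gt0 ?mulr_gt0// ltr_wpDl.
move=> w q wd [gw qg] qL.
have qle (q' : dual X) h : `|q'| <= L -> `|q' h| <= L * `|h|.
  by move=> q'L; apply: le_trans (dual_normP q' h) _; rewrite ler_wpM2r.
have Lwz : 4 * (L * `|w - z|) <= s * e.
  move: wd; rewrite ler_pdivlMr ?mulr_gt0// ?ltr_wpDl//.
  have := normr_ge0 (w - z); nra.
have := q0g w; rewrite -(fineK gw) lee_fin.
have := qg (z + s *: v); rewrite -(fineK gs) lee_fin.
have -> : q (z + s *: v - w) = s * q v - q (w - z).
  have -> : z + s *: v - w = s *: v - (w - z).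
    by rewrite opprB addrAC addrC.
  by rewrite linearB linearZ.
have := qle q (w - z) qL; have := qle q0 (w - z) q0L.
rewrite !ler_norml => /andP[q0wz _] /andP[_ qwz] gsw gwz.
by rewrite -(ler_pM2l s0); lra.
Qed.

(** Weak* continuity of bounded subgradients at a point of Gateaux
    differentiability. *)
Lemma gateaux_subgradient_cvg g z p q0 v (L e : R) :
  gateaux_derivative g z p -> subgradient g z q0 -> `|q0| <= L -> 0 < e ->
  exists2 d : R, 0 < d & forall w q, `|w - z| <= d -> subgradient g w q ->
    `|q| <= L -> `|q v - p v| <= e.
Proof.
move=> dg q0g q0L e0.
have [d1 d10 H1] := gateaux_subgradient_le v dg q0g q0L e0.
have [d2 d20 H2] := gateaux_subgradient_le (- v) dg q0g q0L e0.
exists (Num.min d1 d2); first by rewrite lt_min d10.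
move=> w q; rewrite le_min => /andP[w1 w2] qg qL.
have := H1 w q w1 qg qL; have := H2 w q w2 qg qL.
by rewrite !linearN ler_norml; lra.
Qed.

Lemma gateaux_derivative_subgradient g z p q0 :
  gateaux_derivative g z p -> subgradient g z q0 -> subgradient g z p.
Proof.
move=> dg q0g; suff -> : p = q0 by [].
apply/val_inj/funext => v; apply/eqP; rewrite eq_sym -subr_eq0 -normr_le0.
apply/ler_addgt0Pr => e e0; rewrite add0r.
have [d d0 H] := gateaux_subgradient_cvg v dg q0g (lexx _) e0.
by apply: (H z q0) => //; rewrite subrr normr0 ltW.
Qed.

Lemma differentiable_remainder (f : X -> R) x p :
  (forall e, 0 < e -> exists2 d, 0 < d & forall h, `|h| <= d ->
     `|f (x + h) - f x - p h| <= e * `|h|) ->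
  differentiable f x.
Proof.
move=> H.
have fE : f \o shift x = cst (f x) + p +o_ (0 : X) id.
  apply/eqaddoP => e e0; have [d d0 hd] := H _ e0.
  near=> h; rewrite /= !fctE /= opprD addrA [h + x]addrC; apply: hd.
  near: h; apply/nbhs_normP; exists d => //= h.
  by rewrite /= sub0r normrN => /ltW.
have pE := diff_unique (@dual_continuous _ _ p) fE.
apply/diff_locallyP; rewrite pE; split => //; exact: dual_continuous.
Unshelve. all: by end_near. Qed.

End Gateaux.

(** * Limited embeddings turn Gateaux into Frechet differentiability *)

Section LimitedEmbedding.
Context {R : realType} {E : normedModType R}.
Implicit Types (g : dual (dual E) -> \bar R) (x h : E).
Local Notation i := (bidual_embedding E).

Lemma bidual_embedding_le h : `|i h| <= `|h|.
Proof.
apply: opnorm_le => p p1; apply: le_trans (dual_normP p h) _.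
by rewrite ler_piMl.
Qed.

(** If the estimate failed, it would fail along points [x + h] tending to [x];
    the subgradients at these points, minus the derivative, would then form a
    weak* null sequence whose suprema on the image of the unit ball exceed [e]. *)
Lemma limited_frechet_remainder g x p (L r e : R) :
  limited_operator i ->
  gateaux_derivative g (i x) p -> 0 < r ->
  (forall w, `|w - i x| <= r -> g w \is a fin_num /\
     exists2 q, `|q| <= L & subgradient g w q) ->
  0 < e -> exists2 d, 0 < d & forall h, `|h| <= d ->
    `|fine (g (i (x + h))) - fine (g (i x)) - p (i h)| <= e * `|h|.
Proof.
move=> [_ ilim] dg r0 sg e0; apply: contrapT => nd.
have [gx [q0 q0L q0g]] : g (i x) \is a fin_num /\
    exists2 q, `|q| <= L & subgradient g (i x) q.
  by apply: sg; rewrite subrr normr0 ltW.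
have [_ pg] := gateaux_derivative_subgradient dg q0g.
have : forall n : nat, exists hq : E * dual (dual (dual E)),
    [/\ `|i (x + hq.1) - i x| <= r / n.+1%:R, `|hq.2| <= L,
        subgradient g (i (x + hq.1)) hq.2 &
        e * `|hq.1| < (hq.2 - p) (i hq.1)].
  move=> n; apply: contrapT => nh; apply: nd.
  exists (r / n.+1%:R); first by rewrite divr_gt0.
  move=> h hn; rewrite leNgt; apply/negP => eh; apply: nh.
  have iD : i (x + h) - i x = i h by rewrite linearD addrAC subrr add0r.
  have ihn : `|i (x + h) - i x| <= r / n.+1%:R.
    by rewrite iD (le_trans (bidual_embedding_le h)).
  have [|gh [q qL qg]] := sg (i (x + h)).
    apply: le_trans ihn _; rewrite ler_pdivrMr//.
    by rewrite ler_peMr ?(ltW r0)// ler1n.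
  exists (h, q); split => //=; apply: lt_le_trans eh _.
  have := pg (i (x + h)); rewrite -(fineK gh) lee_fin iD => ph.
  have := qg.2 (i x); rewrite -(fineK gx) lee_fin.
  rewrite -(opprB (i (x + h))) iD linearN => qh.
  rewrite [leRHS](_ : _ = q (i h) - p (i h))//.
  by rewrite ger0_norm; lra.
move=> /choice[hq hqP].
pose P n := (hq n).2 - p.
have P0 v : P n v @[n --> \oo] --> (0 : R).
  apply/cvgrPdist_le => e' e'0.
  have [d d0 H] := gateaux_subgradient_cvg v dg q0g q0L e'0.
  near=> n; rewrite sub0r normrN -[P n v]/((hq n).2 v - p v).
  have [hn qL qg _] := hqP n; apply: H qg qL; apply: le_trans hn _.
  rewrite ler_pdivrMr// -ler_pdivrMl// mulrC.
  apply: ltW; apply: lt_le_trans (truncnS_gt _) _.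
  rewrite ler_nat ltnS; near: n; exact: nbhs_infty_ge.
have /ilim Plim := P0.
have e_nbhs : nbhs (0%E : \bar R) [set y | (y < e%:E)%E].
  apply: open_nbhs_nbhs; split; first exact: open_ereal_lt_ereal.
  by rewrite /= lte_fin.
have [n _ /(_ n (leqnn n))] := Plim _ e_nbhs.
rewrite /= ltNge => /negP; apply.
have [_ _ _ en] := hqP n; set h := (hq n).1 in en.
have h0 : 0 < `|h|.
  rewrite normr_gt0; apply/eqP => h0.
  by move: en; rewrite h0 !linear0 normr0 mulr0 ltxx.
(* evaluate at the unit vector along [h] *)
apply: (@le_trans _ _ (`|P n (i (`|h|^-1 *: h))|)%:E).
  rewrite lee_fin; apply: le_trans (ler_norm _).
  rewrite !linearZ /= -ler_pdivrMl ?invr_gt0// invrK mulrC.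
  exact: ltW.
apply: ereal_sup_ubound; exists (i (`|h|^-1 *: h)) => //.
exists (`|h|^-1 *: h) => //; apply/unit_ballE.
by rewrite normrZ normfV normr_id mulVf ?gt_eqF.
Unshelve. all: by end_near. Qed.

Theorem limited_gateaux_frechet g x :
  limited_operator i ->
  (forall z, g z != -oo%E) -> econvex g -> lower_semicontinuous g ->
  interior (edom g) (i x) -> gateaux_differentiable g (i x) ->
  frechet_differentiable (g \o i) x.
Proof.
move=> ilim gN cg lg xg [p dg].
have [L [r [L0 r0 sg]]] :=
  subgradient_near gN cg (lsc_bounded_above_near cg lg xg).
split.
  apply/nbhs_normP; exists r => //= y; rewrite /= => xy.
  have [|//] := sg (i y).
  rewrite -linearB (le_trans (bidual_embedding_le _))// distrC; exact: ltW.
have ilin : scalar (fun h => p (i h)).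
  by move=> a u v; rewrite linearP dual_scalar.
have pi_le h : p (i h) <= `|p| * `|h|.
  apply: le_trans (ler_norm _) _; apply: le_trans (dual_normP _ _) _.
  by rewrite ler_wpM2l// bidual_embedding_le.
have [q qE _] := bounded_scalar_dual (normr_ge0 p) ilin pi_le.
apply: (@differentiable_remainder _ _ _ _ q) => e e0.
have [d d0 H] := limited_frechet_remainder ilim dg r0 sg e0.
by exists d => // h hd; rewrite qE; exact: H.
Qed.

End LimitedEmbedding.

(** * The Fenchel transform and its second iterate *)

Section Fenchel.
Context {R : realType} {X : normedModType R}.
Implicit Types (f : X -> \bar R) (p : dual X) (x y : X).
Local Notation i := (bidual_embedding X).

Lemma fenchel_ub f p x : ((p x)%:E - f x <= fenchel f p)%E.
Proof. by apply: ereal_sup_ubound; exists x. Qed.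

Lemma fenchel_econvex f : econvex (fenchel f).
Proof.
move=> p q t t01; have /andP[t0 t1] := t01.
apply: ge_ereal_sup => _ [x _ <-].
apply: (@le_trans _ _ (t%:E * ((p x)%:E - f x) +
    (1 - t)%R%:E * ((q x)%:E - f x))%E); last first.
  by apply: leeD; apply: lee_wpmul2l; rewrite ?lee_fin ?subr_ge0// fenchel_ub.
rewrite -[(t *: p + (1 - t) *: q) x]/(t * p x + (1 - t) * q x).
case: (f x) => [r||] /=.
- by rewrite -!EFinB -!EFinM -EFinD lee_fin; lra.
- by rewrite leNye.
- have [t_eq0|tn0] := eqVneq t 0.
    by rewrite t_eq0 mul0e add0e subr0 mul1e.
  have tp : 0 < t by rewrite lt_neqAle eq_sym tn0.
  rewrite /= gt0_muley ?lte_fin// addye ?leey//.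
  rewrite gt_eqF// (@lt_le_trans _ _ 0%E)// mule_ge0//.
    by rewrite lee_fin subr_ge0.
  by rewrite addey// leey.
Qed.

Lemma fenchel_lsc f : lower_semicontinuous (fenchel f).
Proof.
move=> p a /ereal_sup_gt[_ [x _ <-]] apx.
exists [set q : dual X | (a%:E < (q x)%:E - f x)%E]; last first.
  by move=> q /= /lt_le_trans; apply; exact: fenchel_ub.
case: (f x) apx => [r| |] /= apx; last by apply: filterE => q /=; rewrite ltry.
- have arx : a + r < p x by rewrite -ltrBrDr -lte_fin.
  have arq : nbhs p [set q : dual X | a + r < q x].
    have := @dual_continuous _ _ (i x) p; move/cvgr_gt; exact.
  by apply: filterS arq => q /=; rewrite lte_fin ltrBrDr.
- by rewrite ltNge leNye in apx.
Qed.

End Fenchel.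

Section FenchelMoreau.
Context {R : realType} {X : normedModType R}.
Implicit Types (f : X -> \bar R) (p : dual X) (x y : X).
Local Notation i := (bidual_embedding X).

Lemma fenchel_minorant f p : (forall x, f x != -oo%E) ->
  (fenchel f p < +oo)%E ->
  exists c : R, forall x, ((p x - c)%:E <= f x)%E.
Proof.
move=> fN fp.
have [c fpc] : exists c : R, (fenchel f p <= c%:E)%E.
  by case: (fenchel f p) fp => [c _|//|_]; [exists c|exists 0; rewrite leNye].
exists c => x; have := le_trans (fenchel_ub f p x) fpc.
by case: (f x) (fN x) => [r||]//=; rewrite ?leey// -EFinB !lee_fin; lra.
Qed.

Lemma bifenchel_neq_ninfty f p (z : dual (dual X)) :
  (fenchel f p < +oo)%E -> fenchel (fenchel f) z != -oo%E.
Proof.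
move=> fp; have := fenchel_ub (fenchel f) z p.
by apply: contraPneq => ->; case: (fenchel f p) fp.
Qed.

(** The Fenchel-Moreau theorem. Given a real [a] below [f y], lower
    semicontinuity near [y] and the affine minorant given by a point where the
    transform is finite place [f] above the cone [a - L * `|v - y|] when [L] is
    large, and this cone is separated from [f] by an affine function. *)
Theorem fenchel_moreau f : (forall x, f x != -oo%E) -> econvex f ->
  lower_semicontinuous f -> (exists p, (fenchel f p < +oo)%E) ->
  fenchel (fenchel f) \o i = f.
Proof.
move=> fN cf lf [p0 p0f]; apply/funext => y /=.
have [c fc] := fenchel_minorant fN p0f.
apply/eqP; rewrite eq_le; apply/andP; split.
  apply: ge_ereal_sup => _ [p _ <-]; rewrite -[i y p]/(p y).
  have := fenchel_ub f p y.
  case: (f y) (fN y) => [r||]// _; last by rewrite leey.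
  case: (fenchel f p) => [b||]//=; last by rewrite leNye.
  by rewrite -!EFinB !lee_fin; lra.
have below (a : R) : (a%:E < f y)%E -> (a%:E <= fenchel (fenchel f) (i y))%E.
  move=> afy; have [V /nbhs_ballP[r /= r0 rV] aV] := lf _ _ afy.
  pose A := p0 y - c.
  (* outside the ball of radius [r], the second term absorbs [a - A] *)
  pose L := `|p0| + `|a - A| / r.
  have L0 : 0 <= L by rewrite addr_ge0// divr_ge0// ltW.
  have aL v : ((a - L * `|v - y|)%:E <= f v)%E.
    have [vr|vr] := ltP `|v - y| r.
      apply: le_trans (ltW (aV v _)); last first.
        by apply: rV; rewrite -ball_normE /= distrC.
      by rewrite lee_fin gerBl mulr_ge0.
    apply: le_trans (fc v); rewrite lee_fin.
    have := dual_normP p0 (v - y); rewrite linearB ler_norml => /andP[+ _].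
    have : `|a - A| <= `|a - A| / r * `|v - y|.
      by rewrite -mulrA ler_peMr// ler_pdivlMl// mulr1.
    have := ler_norm (a - A).
    by rewrite /L /A mulrDl; lra.
  have [p _ pf] := affine_minorant cf L0 aL.
  apply: le_trans (fenchel_ub (fenchel f) (i y) p).
  rewrite -[i y p]/(p y).
  have fp : (fenchel f p <= (p y - a)%:E)%E.
    apply: ge_ereal_sup => _ [v _ <-]; have := pf v.
    case: (f v) (fN v) => [b||]//= _; last by rewrite leNye.
    by rewrite -EFinB !lee_fin linearB; lra.
  case: (fenchel f p) fp => [b||]//=; last by rewrite leey.
  by rewrite -EFinB !lee_fin; lra.
rewrite leNgt; apply/negP.
have : (fenchel (fenchel f) (i y) != -oo)%E by exact: bifenchel_neq_ninfty p0f.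
case: (fenchel (fenchel f) (i y)) below => [b||]// below _; last first.
  by rewrite ltNge leey.
case fyE : (f y) below (fN y) => [r||]// below _.
  rewrite lte_fin => br; have := below ((b + r) / 2).
  by rewrite lte_fin lee_fin midf_lt// => /(_ isT); lra.
by move=> _; have := below (b + 1); rewrite ltry lee_fin => /(_ isT); lra.
Qed.

End FenchelMoreau.

Theorem corollary1 (R : realType) (E : completeNormedModType R)
  (i_limited : limited_operator (bidual_embedding E)) :
  (forall (g : dual (dual E) -> \bar R) (x : E),
      (forall z, g z != -oo%E) ->
      econvex g ->
      lower_semicontinuous g ->
      interior (edom g) (bidual_embedding E x) ->
      gateaux_differentiable g (bidual_embedding E x) ->
      frechet_differentiable (g \o bidual_embedding E) x) /\
  (forall (f : E -> \bar R) (x : E),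
      (forall y, f y != -oo%E) ->
      econvex f ->
      lower_semicontinuous f ->
      interior (edom (fenchel (fenchel f))) (bidual_embedding E x) ->
      gateaux_differentiable (fenchel (fenchel f)) (bidual_embedding E x) ->
      frechet_differentiable f x).
Proof.
split=> [g x gN cg lg xg dg|f x fN cf lf xf df].
  exact: limited_gateaux_frechet.
have fin : fenchel (fenchel f) (bidual_embedding E x) \is a fin_num.
  have [p /(_ 0)[/nbhs_singleton + _]] := df.
  by rewrite scale0r addr0.
have [p fp] : exists p, (fenchel f p < +oo)%E.
  apply: contrapT => /forallNP nfin; move: fin; rewrite fin_numE => /andP[+ _].
  move=> /negP; apply; rewrite -leeNy_eq; apply: ge_ereal_sup => _ [p _ <-].
  by have /negP := nfin p; rewrite -leNgt leye_eq => /eqP ->.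
rewrite -(fenchel_moreau fN cf lf (ex_intro _ p fp)).
apply: limited_gateaux_frechet => //.
- by move=> z; exact: bifenchel_neq_ninfty fp.
- exact: fenchel_econvex.
- exact: fenchel_lsc.
Qed.
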